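(* For every even integer $2n\ge 4$ there exists a Fedosov manifold $(M,\omega,\nabla)$ of dimension $2n$ such that $\nabla$ is of S-type and $(M,\nabla)$ is not locally symmetric.
   Context: A Fedosov manifold $(M,\omega,\nabla)$ is a symplectic manifold $(M,\omega)$ with a symplectic connection, i.e. a torsion-free affine connection $\nabla$ with $\nabla\omega=0$. $\nabla$ is of S-type if every $p\in M$ has a symmetric normal neighborhood $U$ (the diffeomorphic image under $\exp_p$ of a star-shaped neighborhood $V=-V$ of $0\in T_pM$) such that $s_p^*(\omega|_U)=\omega|_U$, where $s_p(\exp_p(v))=\exp_p(-v)$ is the local geodesic symmetry. Locally symmetric means that the curvature tensor is parallel, $\nabla R=0$ (equivalently, the local geodesic symmetries are local affine transformations). *)

(* Defs.v *)
From HB Require Import structures.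
From mathcomp Require Import all_boot all_order all_algebra.
From mathcomp Require Import all_classical all_reals all_analysis.
Import Order.TTheory GRing.Theory Num.Theory.
Import numFieldNormedType.Exports.

Set Implicit Arguments.
Unset Strict Implicit.
Unset Printing Implicit Defensive.

Local Open Scope classical_set_scope.
Local Open Scope ring_scope.

(* MathComp-Analysis world, over an arbitrary R : realType. *)

Fixpoint Ck (R : realType) (V W : normedModType R) (k : nat)
    (A : set V) (f : V -> W) : Prop :=
  if k is k'.+1 then
    (forall x, A x -> differentiable f x) /\ (forall v, Ck k' A ('D_v f))
  else forall x, A x -> {for x, continuous f}.

(* Only ever used with A open. *)
Definition smooth_on (R : realType) (V W : normedModType R)
    (A : set V) (f : V -> W) : Prop := forall k, Ck k A f.

(* The atlas is indexed by the points: [chart p] is a chart around p, defined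
   on the open set [chart_dom p], with inverse [chart_inv p].  Any atlas
   yields one of this form with the same smooth structure (choose a chart
   around each point).  The values of [chart p] outside [chart_dom p], and of
   [chart_inv p] outside its image, are irrelevant. *)
Record manifold (R : realType) (d : nat) := Manifold {
  carrier :> topologicalType;
  manifold_hausdorff : hausdorff_space carrier;
  manifold_second_countable : @second_countable carrier;
  chart_dom : carrier -> set carrier;
  chart : carrier -> carrier -> 'rV[R]_d;
  chart_inv : carrier -> 'rV[R]_d -> carrier;
  chart_dom_center : forall p, chart_dom p p;
  chart_dom_open : forall p, open (chart_dom p);
  chart_image_open : forall p, open (chart p @` chart_dom p);
  chartK : forall p q, chart_dom p q -> chart_inv p (chart p q) = q;
  chart_continuous : forall p q,
    chart_dom p q -> {for q, continuous (chart p)};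
  chart_inv_continuous : forall p x,
    (chart p @` chart_dom p) x -> {for x, continuous (chart_inv p)};
  chart_transition : forall p q,
    smooth_on (chart p @` (chart_dom p `&` chart_dom q))
              (chart q \o chart_inv p)
}.

(* The tangent space at q is represented by R^d, read in the chart [chart q];
   its elements are row vectors throughout.  [tcoord p q v] is the expression in the chart p of the tangent
   vector v at q (for q in the domain of the chart p). *)
Definition tcoord (R : realType) (d : nat) (M : manifold R d) (p q : M)
    (v : 'rV[R]_d) : 'rV[R]_d :=
  'd (chart p \o chart_inv q) (chart q q) v.

Definition smooth_into (R : realType) (d : nat) (M : manifold R d)
    (V : normedModType R) (A : set V) (f : V -> M) : Prop :=
  (forall x, A x -> {for x, continuous f}) /\
  (forall p, smooth_on (A `&` f @^-1` chart_dom p) (chart p \o f)).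

Definition smooth_from (R : realType) (d : nat) (M : manifold R d)
    (W : normedModType R) (U : set M) (f : M -> W) : Prop :=
  forall p, smooth_on (chart p @` (U `&` chart_dom p)) (f \o chart_inv p).

Definition smooth_fun (R : realType) (d : nat) (M : manifold R d)
    (f : M -> R) : Prop := smooth_from setT f.

Definition vfield (R : realType) (d : nat) (M : manifold R d) : Type :=
  M -> 'rV[R]_d.

Definition vf_in (R : realType) (d : nat) (M : manifold R d) (p : M)
    (X : vfield M) (x : 'rV[R]_d) : 'rV[R]_d :=
  tcoord p (chart_inv p x) (X (chart_inv p x)).

Definition smooth_vf (R : realType) (d : nat) (M : manifold R d)
    (X : vfield M) : Prop :=
  forall p, smooth_on (chart p @` chart_dom p) (vf_in p X).

(* The derivative X f of f along X. *)
Definition vf_act (R : realType) (d : nat) (M : manifold R d)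
    (X : vfield M) (f : M -> R) : M -> R :=
  fun q => 'd (f \o chart_inv q) (chart q q) (X q).

(* [X, Y] = DY(X) - DX(Y) in a chart. *)
Definition bracket (R : realType) (d : nat) (M : manifold R d)
    (X Y : vfield M) : vfield M :=
  fun q => 'd (vf_in q Y) (chart q q) (X q) - 'd (vf_in q X) (chart q q) (Y q).

(* [nabla X Y] is only meaningful for smooth X and Y. *)
Record affine_connection (R : realType) (d : nat) (M : manifold R d) :=
  AffineConnection {
  nabla :> vfield M -> vfield M -> vfield M;
  nabla_smooth : forall X Y, smooth_vf X -> smooth_vf Y ->
    smooth_vf (nabla X Y);
  nabla_linear_l : forall (f : M -> R) X X' Y, smooth_fun f ->
    smooth_vf X -> smooth_vf X' -> smooth_vf Y ->
    forall q, nabla (fun r => f r *: X r + X' r) Y q =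
              f q *: nabla X Y q + nabla X' Y q;
  nabla_add_r : forall X Y Y', smooth_vf X -> smooth_vf Y -> smooth_vf Y' ->
    forall q, nabla X (fun r => Y r + Y' r) q = nabla X Y q + nabla X Y' q;
  nabla_leibniz : forall (f : M -> R) X Y, smooth_fun f ->
    smooth_vf X -> smooth_vf Y ->
    forall q, nabla X (fun r => f r *: Y r) q =
              vf_act X f q *: Y q + f q *: nabla X Y q
}.

Definition torsion_free (R : realType) (d : nat) (M : manifold R d)
    (D : affine_connection M) : Prop :=
  forall X Y, smooth_vf X -> smooth_vf Y ->
  forall q, D X Y q - D Y X q = bracket X Y q.

Definition curvature (R : realType) (d : nat) (M : manifold R d)
    (D : affine_connection M) (X Y Z : vfield M) : vfield M :=
  fun q => D X (D Y Z) q - D Y (D X Z) q - D (bracket X Y) Z q.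

Definition nabla_curvature (R : realType) (d : nat) (M : manifold R d)
    (D : affine_connection M) (W X Y Z : vfield M) : vfield M :=
  fun q => D W (curvature D X Y Z) q - curvature D (D W X) Y Z q
           - curvature D X (D W Y) Z q - curvature D X Y (D W Z) q.

Definition locally_symmetric (R : realType) (d : nat) (M : manifold R d)
    (D : affine_connection M) : Prop :=
  forall W X Y Z, smooth_vf W -> smooth_vf X -> smooth_vf Y -> smooth_vf Z ->
  forall q, nabla_curvature D W X Y Z q = 0.

Record symplectic_form (R : realType) (d : nat) (M : manifold R d) :=
  SymplecticForm {
  omega :> M -> 'rV[R]_d -> 'rV[R]_d -> R;
  omega_linear_l : forall (q : M) (v : 'rV[R]_d), scalar (fun u => omega q u v);
  omega_linear_r : forall (q : M) (u : 'rV[R]_d), scalar (fun v => omega q u v);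
  omega_alternating : forall (q : M) (u : 'rV[R]_d), omega q u u = 0;
  omega_nondegenerate : forall (q : M) (u : 'rV[R]_d),
    (forall v : 'rV[R]_d, omega q u v = 0) -> u = 0;
  omega_smooth : forall X Y : vfield M, smooth_vf X -> smooth_vf Y ->
    smooth_fun (fun q => omega q (X q) (Y q));
  omega_closed : forall X Y Z : vfield M,
    smooth_vf X -> smooth_vf Y -> smooth_vf Z ->
    forall q,
      vf_act X (fun r => omega r (Y r) (Z r)) q
      - vf_act Y (fun r => omega r (X r) (Z r)) q
      + vf_act Z (fun r => omega r (X r) (Y r)) q
      - omega q (bracket X Y q) (Z q)
      + omega q (bracket X Z q) (Y q)
      - omega q (bracket Y Z q) (X q) = 0
}.

Definition parallel_form (R : realType) (d : nat) (M : manifold R d)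
    (D : affine_connection M) (w : symplectic_form M) : Prop :=
  forall X Y Z : vfield M, smooth_vf X -> smooth_vf Y -> smooth_vf Z ->
  forall q, vf_act X (fun r => w r (Y r) (Z r)) q =
            w q (D X Y q) (Z q) + w q (Y q) (D X Z q).

Record fedosov_manifold (R : realType) (d : nat) := FedosovManifold {
  fed_manifold :> manifold R d;
  fed_form : symplectic_form fed_manifold;
  fed_connection : affine_connection fed_manifold;
  fed_torsion_free : torsion_free fed_connection;
  fed_parallel : parallel_form fed_connection fed_form
}.

(* The graph of the Christoffel symbols of D in the chart p at x: the k-th
   coordinate of w is \sum_(i, j) Gamma^k_(i j)(x) u_i v_j, i.e., w expresses
   nabla_U V at x for vector fields U, V which near x have the constant
   coordinates u, v in the chart p. *)
Definition christoffel (R : realType) (d : nat) (M : manifold R d)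
    (D : affine_connection M) (p : M) (x u v w : 'rV[R]_d) : Prop :=
  exists U V : vfield M,
    [/\ smooth_vf U, smooth_vf V,
        \forall y \near x, vf_in p U y = u,
        \forall y \near x, vf_in p V y = v &
        vf_in p (D U V) x = w].

(* The geodesic equation c'' + Gamma(c', c') = 0 holds in every chart. *)
Definition geodesic (R : realType) (d : nat) (M : manifold R d)
    (D : affine_connection M) (J : set R) (g : R -> M) : Prop :=
  [/\ open J, smooth_into J g &
      forall t p, J t -> chart_dom p (g t) ->
      let c : R -> 'rV[R]_d := chart p \o g in
      exists2 w, christoffel D p (c t) (derive1 c t) (derive1 c t) w &
                 derive1n 2 c t + w = 0].

(* [is_exp D p v q] : exp_p is defined at v, with value q. *)
Definition is_exp (R : realType) (d : nat) (M : manifold R d)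
    (D : affine_connection M) (p : M) (v : 'rV[R]_d) (q : M) : Prop :=
  exists (J : set R) (g : R -> M),
    [/\ geodesic D J g, `[0, 1] `<=` J, g 0 = p,
        derive1 (chart p \o g) 0 = v & g 1 = q].

(* e is exp_p restricted to V, a diffeomorphism from V to the open set U,
   with inverse l. *)
Definition symmetric_normal_nbhd (R : realType) (d : nat) (M : manifold R d)
    (D : affine_connection M) (p : M) (V : set 'rV[R]_d)
    (e : 'rV[R]_d -> M) (U : set M) (l : M -> 'rV[R]_d) : Prop :=
  [/\ open V, V 0,
      (forall v (t : R), V v -> 0 <= t <= 1 -> V (t *: v)),
      (forall v, V (- v) <-> V v) &
      [/\ (forall v, V v -> is_exp D p v (e v)),
          open U, U = e @` V,
          (forall v, V v -> l (e v) = v) &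
          smooth_into V e /\ smooth_from U l]].

(* (s^* w)|_U = w|_U *)
Definition preserves_form (R : realType) (d : nat) (M : manifold R d)
    (w : symplectic_form M) (U : set M) (s : M -> M) : Prop :=
  forall q, U q -> forall u v : 'rV[R]_d,
  let ds := 'd (chart (s q) \o s \o chart_inv q) (chart q q) in
  w (s q) (ds u) (ds v) = w q u v.

Definition S_type (R : realType) (d : nat) (M : manifold R d)
    (w : symplectic_form M) (D : affine_connection M) : Prop :=
  forall p : M, exists V e U l,
    symmetric_normal_nbhd D p V e U l /\
    preserves_form w U (fun q => e (- l q)).

(* Main.v *)
Require Import Defs.
From HB Require Import structures.
From mathcomp Require Import all_boot all_order all_algebra.
From mathcomp Require Import all_classical all_reals all_analysis.
From mathcomp Require Import ring lra.
Import Order.TTheory GRing.Theory Num.Theory.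
Import numFieldNormedType.Exports.

(** The manifold is R^2n with its standard symplectic form w, in one global
    chart, and the connection is the flat one plus Christoffel symbols that are
    quadratic in the position: Gamma(x)(u, v) = Q x x u v for a quadrilinear
    map Q, symmetric in its first two and in its last two arguments.  It is
    torsion-free by the second symmetry, and it preserves w exactly when
    w (Q x h u v) t is symmetric in u, v, t.

    Assume moreover that the values of Q are killed by Q in every slot.  In the
    example, Q only sees the positions of its arguments and its values are pure
    momenta.  Then the geodesic equation integrates at once, because the
    correction to a straight line is never seen by Gamma:
      c(t) = x + t v - t^2/2 Q x x v v - t^3/3 Q x v v v - t^4/12 Q v v v v.
    The last hypothesis, Q v v v v = 0, removes the t^4 term.  The exponential
    map at x is then a polynomial diffeomorphism of the whole space with a
    polynomial inverse, and the geodesic symmetry is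
      y |-> x - (y - x) - Q x x (y - x) (y - x),
    since the term in Q x v v v is odd in v and cancels.  Its differential is
    u |-> - u - 2 Q x x (y - x) u; it preserves w because Q x x (y - x) is
    skew for w and squares to zero ([quadratic_symmetry_invariant]).  Hence
    the connection is of S-type ([quadratic_S_type]).

    On constant vector fields all terms that involve a product of two Q's
    vanish, so nabla R is the second derivative of Gamma, skew-symmetrized:
    (nabla_p R)(x, y) z = 2 (Q p x y z - Q p y x z)
    ([quadratic_nabla_curvature]).

    It remains to find Q.  Write S(x)(v) = w (Gamma(x)(v, v)) v up to sign; it
    has degree 2 in x and 3 in v.  The condition Q v v v v = 0 says that the
    polarized form S(v)(v, v, t) vanishes for all v and t, and nabla R = 0 would
    make S the polarization of a quintic form, which this condition forces to
    be 0.  With two position coordinates one can take, up to a factor,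
    S(x)(v) = theta(x, v)^2 v_1, theta being the area form of the plane: every
    term of its polarization keeps a factor theta, which is alternating, but S
    itself is not zero ([area_tensor_diag], [area_tensor_swap23]).  Two position
    coordinates require dimension at least four. *)

Set Implicit Arguments.
Unset Strict Implicit.
Unset Printing Implicit Defensive.

Local Open Scope classical_set_scope.
Local Open Scope ring_scope.

(** * Smooth maps on a whole normed space *)

Section SmoothMaps.
Variables (R : realType) (V W : normedModType R).
Implicit Types (k : nat) (f g : V -> W) (a : V -> R).

Lemma is_diff_scale a f x : differentiable a x -> differentiable f x ->
  is_diff x (fun y => a y *: f y) (fun v => a x *: 'd f x v + 'd a x v *: f x).
Proof.
move=> da df.
have scaleP : bilinear_for (GRing.Scale.Law.clone _ _ *:%R _)
    (GRing.Scale.Law.clone _ _ *:%R _) (@GRing.scale R W).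
  split => [u'|u'] b y z /=; first by rewrite scalerDl scalerA.
  by rewrite scalerDr !scalerA mulrC.
pose bM := bilinear_isBilinear.Build R R W W _ _ (@GRing.scale R W) scaleP.
pose b : {bilinear R -> W -> W} := HB.pack (@GRing.scale R W) bM.
have cb : continuous (fun p => b p.1 p.2) by move=> p; exact: scale_continuous.
have dp : differentiable (fun y => (a y, f y)) x by apply: differentiable_pair.
have -> : (fun y => a y *: f y) =
  (fun p : R * W => b p.1 p.2) \o (fun y => (a y, f y)) by [].
apply: DiffDef.
  by apply: differentiable_comp => //; apply: differentiable_bilin.
rewrite diff_comp //; last exact: differentiable_bilin.
by rewrite diff_bilin // diff_pair.
Qed.

(** The polynomials met here have explicit cubic expansions along lines, so
    reading off the linear term is the shortest way to differentiate them. *)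
Lemma derive_expand f (x v : V) (b c d : W) :
  (forall t : R, f (t *: v + x) = f x + t *: b + t ^+ 2 *: c + t ^+ 3 *: d) ->
  'D_v f x = b.
Proof.
move=> fE; apply: cvg_lim => //.
pose g : R -> W := cst b + (fun t : R => t *: c) + (fun t : R => t ^+ 2 *: d).
have dg : differentiable g 0.
  apply: differentiableD; first apply: differentiableD.
  - exact: differentiable_cst.
  - exact: differentiableZl.
  - by apply: differentiableZl; apply/derivable1_diffP/exprn_derivable.
have gc : g t @[t --> 0^'] --> b.
  have <- : g 0 = b by rewrite /g !fctE expr0n /= !scale0r !addr0.
  apply: cvg_within_filter; exact: (differentiable_continuous dg).
apply: cvg_trans gc; apply: near_eq_cvg.
near=> t.
have t0 : t != 0 by near: t; exact: nbhs_dnbhs_neq.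
have -> : (f \o shift x) (t *: v) - f x = t *: b + t ^+ 2 *: c + t ^+ 3 *: d.
  by rewrite /= fE -!addrA addrC -!addrA addNr addr0.
rewrite /g !fctE !scalerDr !scalerA !(exprS t) expr0 mulr1 !mulKf //.
by rewrite mulVf // scale1r.
Unshelve. all: by end_near. Qed.

Lemma CkS k f : Ck k.+1 setT f -> Ck k setT f.
Proof.
elim: k f => [|k IH] f [df Df].
  by move=> x _; apply/differentiable_continuous/df.
by split=> // v; apply: IH.
Qed.

Lemma Ck_cst k (b : W) : Ck k setT (cst b : V -> W).
Proof.
elim: k b => [|k IH] b /=; first by move=> x _; apply: cst_continuous.
split=> [x _|v]; first exact: differentiable_cst.
have -> : 'D_v (cst b : V -> W) = cst 0.
  by apply/funext => x; rewrite derive_cst.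
exact: IH.
Qed.

Lemma CkD k f g : Ck k setT f -> Ck k setT g -> Ck k setT (fun x => f x + g x).
Proof.
elim: k f g => [|k IH] f g.
  by move=> cf cg x _; apply: cvgD; [exact: cf|exact: cg].
move=> [df Df] [dg Dg]; split=> [x _|v].
  by apply: differentiableD; [exact: df|exact: dg].
have -> : 'D_v (fun x => f x + g x) = (fun x => 'D_v f x + 'D_v g x).
  by apply/funext => x; apply: deriveD; apply: diff_derivable;
    [exact: df|exact: dg].
exact: IH (Df v) (Dg v).
Qed.

Lemma Ck_sum k n (f : 'I_n -> V -> W) : (forall i, Ck k setT (f i)) ->
  Ck k setT (fun x => \sum_(i < n) f i x).
Proof.
elim: n f => [|n IH] f fk.
  have -> : (fun x => \sum_(i < 0) f i x) = cst 0.
    by apply/funext => x; rewrite big_ord0.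
  exact: Ck_cst.
have -> : (fun x => \sum_(i < n.+1) f i x) =
          (fun x => \sum_(i < n) f (widen_ord (leqnSn n) i) x + f ord_max x).
  by apply/funext => x; rewrite big_ord_recr.
by apply: CkD => //; apply: IH.
Qed.

End SmoothMaps.

Section SmoothMultilinear.
Variables (R : realType) (V W : normedModType R).
Implicit Types (k : nat) (f : V -> W) (a : V -> R).

Lemma Ck_scale k a f : Ck k setT a -> Ck k setT f ->
  Ck k setT (fun x => a x *: f x).
Proof.
elim: k a f => [|k IH] a f.
  by move=> ca cf x _; apply: cvgZ; [exact: ca|exact: cf].
move=> ka kf; case: (ka) => da Da; case: (kf) => df Df.
have dd x := is_diff_scale (da x I) (df x I).
split=> [x _|v]; first by case: (dd x).
have -> : 'D_v (fun x => a x *: f x) =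
          (fun x => a x *: 'D_v f x + 'D_v a x *: f x).
  apply/funext => x; rewrite deriveE; last by case: (dd x).
  by rewrite diff_val !deriveE //; [exact: da|exact: df].
apply: CkD; first exact: IH (CkS ka) (Df v).
exact: IH (Da v) (CkS kf).
Qed.

Lemma Ck_linear k (f : {linear V -> W}) : continuous f -> Ck k setT f.
Proof.
move=> cf; case: k => [|k]; first by move=> x _; apply: cf.
split=> [x _|v]; first exact: linear_differentiable.
have -> : 'D_v f = cst (f v).
  apply/funext => x; rewrite deriveE ?diff_lin //.
  exact: linear_differentiable.
exact: Ck_cst.
Qed.

Lemma row_linear_sum m (U : lmodType R) (F : 'rV[R]_m -> U) (u : 'rV[R]_m) :
  linear F -> F u = \sum_(i < m) u 0 i *: F (delta_mx 0 i).
Proof.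
move=> Flin.
pose FM := GRing.isLinear.Build _ _ _ _ _ Flin.
pose FL : {linear _ -> _} := HB.pack F FM.
rewrite {1}(row_sum_delta u) -[F]/(FL : _ -> _) linear_sum.
by apply: eq_bigr => i _; rewrite linearZ.
Qed.

Lemma Ck_coord k m (f : V -> 'rV[R]_m) i : Ck k setT f ->
  Ck k setT (fun x => f x 0 i).
Proof.
elim: k f => [|k IH] f.
  move=> cf x _; apply: (@continuous_comp _ _ _ f (fun M : 'rV[R]_m => M 0 i)).
    exact: cf.
  exact: coord_continuous.
case=> df Df; split=> [x _|v].
  apply: (@differentiable_comp _ _ _ _ f (fun M : 'rV[R]_m => M 0 i)).
    exact: df.
  exact: differentiable_coord.
have -> : 'D_v (fun x => f x 0 i : R) = (fun x => ('D_v f x) 0 i).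
  apply/funext => x.
  by rewrite derive_mx ?mxE //; apply: diff_derivable; exact: df.
exact: IH (Df v).
Qed.

(** Expanding [f x] in the standard basis reduces a linear dependence to sums
    of products.  Used once per slot, this makes a multilinear map of smooth
    functions smooth. *)
Lemma Ck_linear_arg k m (F : 'rV[R]_m -> V -> W) (f : V -> 'rV[R]_m) :
  (forall x, linear (F ^~ x)) -> Ck k setT f ->
  (forall u, Ck k setT (F u)) -> Ck k setT (fun x => F (f x) x).
Proof.
move=> Flin fk Fk.
have -> : (fun x => F (f x) x) =
          (fun x => \sum_(i < m) f x 0 i *: F (delta_mx 0 i) x).
  by apply/funext => x; rewrite (row_linear_sum (f x) (Flin x)).
by apply: Ck_sum => i; apply: Ck_scale => //; apply: Ck_coord.
Qed.

Lemma diff_sum n (f : 'I_n -> V -> W) x v :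
  (forall i, differentiable (f i) x) ->
  differentiable (fun y => \sum_(i < n) f i y) x /\
  'd (fun y => \sum_(i < n) f i y) x v = \sum_(i < n) 'd (f i) x v.
Proof.
move=> df.
have -> : (fun y => \sum_(i < n) f i y) = \sum_(i < n) f i.
  by apply/funext => y; rewrite fct_sumE.
have dS : differentiable (\sum_(i < n) f i) x by exact: differentiable_sum.
split=> //; rewrite -deriveE // derive_sum; last first.
  by move=> i; exact: diff_derivable.
by apply: eq_bigr => i _; rewrite deriveE.
Qed.

(** The product rule, in a form that can be iterated over the slots of a
    multilinear map. *)
Lemma diff_linear_arg m (F : 'rV[R]_m -> V -> W) (f : V -> 'rV[R]_m) x v :
  (forall x, linear (F ^~ x)) -> differentiable f x ->
  (forall u, differentiable (F u) x) ->
  differentiable (fun y => F (f y) y) x /\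
  'd (fun y => F (f y) y) x v = F ('d f x v) x + 'd (F (f x)) x v.
Proof.
move=> Flin df dF.
have dfi i : differentiable (fun y => f y 0 i : R) x.
  apply: (@differentiable_comp _ _ _ _ f (fun M : 'rV[R]_m => M 0 i)) => //.
  exact: differentiable_coord.
have dfiE i : 'd (fun y => f y 0 i : R) x v = ('d f x v) 0 i.
  rewrite -deriveE // -(deriveE _ df) derive_mx ?mxE //.
  exact: diff_derivable.
have -> : (fun y => F (f y) y) =
          (fun y => \sum_(i < m) f y 0 i *: F (delta_mx 0 i) y).
  by apply/funext => y; rewrite (row_linear_sum (f y) (Flin y)).
have -> : F (f x) = (fun y => \sum_(i < m) f x 0 i *: F (delta_mx 0 i) y).
  by apply/funext => y; rewrite (row_linear_sum (f x) (Flin y)).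
have dd i := is_diff_scale (dfi i) (dF (delta_mx 0 i)).
have [|dS ->] := @diff_sum m (fun i y => f y 0 i *: F (delta_mx 0 i) y) x v.
  by move=> i; case: (dd i).
have [|_ ->] := @diff_sum m (fun i y => f x 0 i *: F (delta_mx 0 i) y) x v.
  by move=> i; apply: differentiableZ.
split=> //; rewrite (row_linear_sum _ (Flin x)) -big_split /=.
apply: eq_bigr => i _; case: (dd i) => _ ->; rewrite addrC dfiE.
by rewrite diffZ.
Qed.

End SmoothMultilinear.

Lemma smooth_differentiable (R : realType) (V W : normedModType R) (f : V -> W)
    x :
  smooth_on setT f -> differentiable f x.
Proof. by move=> /(_ 1%N)[df _]; exact: df. Qed.

Lemma smooth_id (R : realType) (V : normedModType R) :
  smooth_on setT (fun x : V => x).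
Proof. by move=> k; apply: (@Ck_linear R V V k idfun) => x. Qed.

Lemma smooth_cst (R : realType) (V W : normedModType R) (b : W) :
  smooth_on setT (fun _ : V => b).
Proof. by move=> k; exact: Ck_cst. Qed.

Lemma smoothD (R : realType) (V W : normedModType R) (f g : V -> W) :
  smooth_on setT f -> smooth_on setT g -> smooth_on setT (fun x => f x + g x).
Proof. by move=> sf sg k; apply: CkD; [exact: sf|exact: sg]. Qed.

Lemma smoothZ (R : realType) (V W : normedModType R) (b : R) (f : V -> W) :
  smooth_on setT f -> smooth_on setT (fun x => b *: f x).
Proof. by move=> sf k; apply: Ck_scale; [exact: Ck_cst|exact: sf]. Qed.

Lemma smooth_exp (R : realType) n : smooth_on setT (fun t : R => t ^+ n).
Proof.
elim: n => [|n IH] k; first exact: Ck_cst.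
have -> : (fun t : R => t ^+ n.+1) = (fun t => t *: t ^+ n).
  by apply/funext => t; rewrite exprS.
by apply: Ck_scale; [exact: smooth_id|exact: IH].
Qed.

Lemma smooth_cubic (R : realType) (d : nat) (p v a b : 'rV[R]_d) :
  smooth_on setT (fun t : R => p + t *: v + t ^+ 2 *: a + t ^+ 3 *: b).
Proof.
by move=> k; do 3?apply: CkD; try apply: Ck_scale; try exact: Ck_cst;
   try exact: smooth_exp; exact: smooth_id.
Qed.

Lemma derive1_cubic (R : realType) (d : nat) (p v a b : 'rV[R]_d)
    (c : R -> 'rV[R]_d) :
  (forall t, c t = p + t *: v + t ^+ 2 *: a + t ^+ 3 *: b) ->
  derive1 c = fun t => v + (2 * t) *: a + (3 * t ^+ 2) *: b.
Proof.
move=> cE; apply/funext => t; rewrite derive1E.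
apply: (@derive_expand _ _ _ _ _ _ _ (a + (3 * t) *: b) b) => s.
by rewrite -[s *: 1]/(s * 1) !cE; apply/rowP => i; rewrite !mxE; ring.
Qed.

(** * Euclidean space as a manifold with one chart *)

Section EuclideanSpace.
Variables (R : realType) (d : nat).
Local Notation E := 'rV[R]_d.

(** The balls with rational centre and radius 1/(k+1) form a basis. *)
Lemma row_second_countable : @second_countable E.
Proof.
pose r (k : nat) : R := k.+1%:R^-1.
have r0 k : 0 < r k by rewrite /r invr_gt0 ltr0n.
pose f (qk : 'rV[rat]_d * nat) : set E := ball (map_mx ratr qk.1 : E) (r qk.2).
exists (range f).
  exact: card_le_trans (card_image_le _ _) (countableP _).
split=> [_ [qk _ <-]|x A]; first exact: ball_open.
move=> /nbhs_ballP[e /= e0 sA].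
have [k ke] : exists k, r k < e / 2.
  have [|k] := @ltr_add_invr R 0 (e / 2); first by rewrite divr_gt0.
  by rewrite add0r; exists k.
have /choice[q qx] : forall i, exists q, ball (x 0 i : R) (r k) (ratr q : R).
  move=> i; have [|q] := @rat_in_itvoo R (x 0 i - r k) (x 0 i + r k).
    by rewrite ltrBlDr -addrA ltrDl addr_gt0.
  rewrite in_itv /= => /andP[q1 q2]; exists q.
  by rewrite /ball /= ltr_norml; apply/andP; split; lra.
have xq : ball x (r k) (map_mx ratr (\row_i q i) : E).
  by split=> // i j; rewrite !mxE ord1.
exists (f (\row_i q i, k)).
  by split; [exists (\row_i q i, k)|apply: ball_sym].
move=> y /= qy; apply: sA; rewrite [e]splitr.
apply: ball_triangle (le_ball (ltW ke) xq) (le_ball (ltW ke) qy).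
Qed.

Definition euclid : manifold R d.
Proof.
refine (@Manifold R d E (@norm_hausdorff R E) row_second_countable
  (fun _ => setT) (fun _ x => x) (fun _ x => x) _ _ _ _ _ _ _).
- by [].
- by move=> _; apply: openT.
- by move=> _; rewrite image_id; apply: openT.
- by [].
- by move=> _ q _.
- by move=> _ q _.
- by move=> _ _; rewrite image_id setTI; apply: smooth_id.
Defined.

Implicit Types (p q : euclid) (X Y : vfield euclid) (f : euclid -> R).

Lemma tcoord_euclid p q v : tcoord p q v = v.
Proof.
have -> : tcoord p q = 'd (@id E) q by [].
by rewrite (@diff_val _ _ _ _ _ _ _ (is_diff_id _)).
Qed.

Lemma vf_in_euclid p X : vf_in p X = X.
Proof. by apply/funext => x; apply: tcoord_euclid. Qed.

Lemma smooth_vf_euclid X : smooth_vf X <-> smooth_on setT (X : E -> E).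
Proof.
split=> [/(_ 0)|sX p]; rewrite vf_in_euclid image_id //.
Qed.

Lemma smooth_fun_euclid f : smooth_fun f <-> smooth_on setT (f : E -> R).
Proof.
by split=> [/(_ 0)|sX p]; rewrite /= setTI image_id //.
Qed.

Lemma vf_act_euclid X f q : vf_act X f q = 'd (f : E -> R) q (X q).
Proof. by []. Qed.

Lemma bracket_euclid X Y q :
  bracket X Y q = 'd (Y : E -> E) q (X q) - 'd (X : E -> E) q (Y q).
Proof. by rewrite /bracket !vf_in_euclid. Qed.

End EuclideanSpace.

(** * Constant symplectic forms *)

Section ConstantForm.
Variables (R : realType) (d : nat).
Local Notation E := 'rV[R]_d.
Variable w : E -> E -> R.
Hypothesis w_linear_l : forall v, scalar (w ^~ v).
Hypothesis w_linear_r : forall u, scalar (w u).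
Hypothesis w_alternating : forall u, w u u = 0.
Hypothesis w_nondegenerate : forall u, (forall v, w u v = 0) -> u = 0.

Lemma formDl u u' v : w (u + u') v = w u v + w u' v.
Proof. by have := w_linear_l v 1 u u'; rewrite scale1r mul1r. Qed.

Lemma formDr u v v' : w u (v + v') = w u v + w u v'.
Proof. by have := w_linear_r u 1 v v'; rewrite scale1r mul1r. Qed.

Lemma form0l v : w 0 v = 0.
Proof. by apply: (addrI (w 0 v)); rewrite -formDl !addr0. Qed.

Lemma form0r u : w u 0 = 0.
Proof. by apply: (addrI (w u 0)); rewrite -formDr !addr0. Qed.

Lemma formZl a u v : w (a *: u) v = a * w u v.
Proof. by have := w_linear_l v a u 0; rewrite form0l !addr0. Qed.

Lemma formZr a u v : w u (a *: v) = a * w u v.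
Proof. by have := w_linear_r u a v 0; rewrite form0r !addr0. Qed.

Lemma formNl u v : w (- u) v = - w u v.
Proof. by rewrite -scaleN1r formZl mulN1r. Qed.

Lemma formNr u v : w u (- v) = - w u v.
Proof. by rewrite -scaleN1r formZr mulN1r. Qed.

Lemma form_anti u v : w u v = - w v u.
Proof.
apply/eqP; rewrite -addr_eq0; apply/eqP.
have := w_alternating (u + v).
by rewrite !formDl !formDr !w_alternating add0r addr0.
Qed.

Lemma smooth_form (X Y : E -> E) : smooth_on setT X -> smooth_on setT Y ->
  smooth_on setT (fun q => w (X q) (Y q)).
Proof.
move=> sX sY k.
apply: (@Ck_linear_arg _ _ _ k d (fun u q => w u (Y q))) => [q||u].
- exact: w_linear_l.
- exact: sX.
apply: (@Ck_linear_arg _ _ _ k d (fun v q => w u v)) => [q||v].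
- exact: w_linear_r.
- exact: sY.
- exact: Ck_cst.
Qed.

Lemma diff_form (X Y : E -> E) q v : differentiable X q -> differentiable Y q ->
  'd (fun q => w (X q) (Y q)) q v = w ('d X q v) (Y q) + w (X q) ('d Y q v).
Proof.
move=> dX dY.
have dr u : differentiable (fun q => w u (Y q)) q /\
    'd (fun q => w u (Y q)) q v = w u ('d Y q v).
  have [|//||dw ->] := @diff_linear_arg _ _ _ d (fun v q => w u v) Y q v.
  - by move=> x; exact: w_linear_r.
  - by move=> y; exact: differentiable_cst.
  by split=> //; rewrite (diff_cst (w u (Y q)) q) addr0.
have [||u|_ ->] := @diff_linear_arg _ _ _ d (fun u q => w u (Y q)) X q v.
- by move=> x; exact: w_linear_l.
- by [].
- by have [] := dr u.
by have [_ ->] := dr (X q).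
Qed.

(** This is dw = 0 at a point, with [xy] for the derivative of Y along X, and
    so on: the terms cancel in pairs by antisymmetry. *)
Lemma closed_form_algebra (x y z xy xz yx yz zx zy : E) :
  w xy z + w y xz - (w yx z + w x yz) + (w zx y + w x zy)
  - w (xy - yx) z + w (xz - zx) y - w (yz - zy) x = 0.
Proof.
rewrite !formDl !formNl (form_anti y xz) (form_anti x yz) (form_anti x zy).
by ring.
Qed.

Definition constant_form : symplectic_form (euclid R d).
Proof.
refine (@SymplecticForm R d (euclid R d) (fun _ => w) (fun _ => w_linear_l)
  (fun _ => w_linear_r) (fun _ => w_alternating) (fun _ => w_nondegenerate)
  _ _).
- move=> X Y /smooth_vf_euclid sX /smooth_vf_euclid sY.
  exact/smooth_fun_euclid/smooth_form.
- move=> X Y Z /smooth_vf_euclid sX /smooth_vf_euclid sY /smooth_vf_euclid sZ q.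
  have dX := smooth_differentiable q sX; have dY := smooth_differentiable q sY.
  have dZ := smooth_differentiable q sZ.
  rewrite !bracket_euclid !vf_act_euclid.
  rewrite (diff_form _ dY dZ) (diff_form _ dX dZ) (diff_form _ dX dY).
  exact: closed_form_algebra.
Defined.

End ConstantForm.

(** * Connections with quadratic Christoffel symbols *)

Section QuadraticConnection.
Variables (R : realType) (d : nat).
Local Notation E := 'rV[R]_d.
Variable Q : E -> E -> E -> E -> E.
Hypothesis Q_linear1 : forall h u v, linear (fun x => Q x h u v).
Hypothesis Q_linear3 : forall x h v, linear (fun u => Q x h u v).
Hypothesis Q_sym12 : forall x h u v, Q x h u v = Q h x u v.
Hypothesis Q_sym34 : forall x h u v, Q x h u v = Q x h v u.

Lemma Q_linear2 x u v : linear (fun h => Q x h u v).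
Proof. by move=> a h h'; rewrite !(Q_sym12 x) Q_linear1. Qed.

Lemma Q_linear4 x h u : linear (fun v => Q x h u v).
Proof. by move=> a v v'; rewrite !(Q_sym34 _ _ u) Q_linear3. Qed.

Lemma QD1 x x' h u v : Q (x + x') h u v = Q x h u v + Q x' h u v.
Proof. by have := Q_linear1 h u v 1 x x'; rewrite !scale1r. Qed.

Lemma QD2 x h h' u v : Q x (h + h') u v = Q x h u v + Q x h' u v.
Proof. by rewrite !(Q_sym12 x) QD1. Qed.

Lemma QD3 x h u u' v : Q x h (u + u') v = Q x h u v + Q x h u' v.
Proof. by have := Q_linear3 x h v 1 u u'; rewrite !scale1r. Qed.

Lemma QD4 x h u v v' : Q x h u (v + v') = Q x h u v + Q x h u v'.
Proof. by rewrite !(Q_sym34 _ _ u) QD3. Qed.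

Lemma Q01 h u v : Q 0 h u v = 0.
Proof. by apply: (addrI (Q 0 h u v)); rewrite -QD1 !addr0. Qed.

Lemma Q03 x h v : Q x h 0 v = 0.
Proof. by apply: (addrI (Q x h 0 v)); rewrite -QD3 !addr0. Qed.

Lemma QZ1 a x h u v : Q (a *: x) h u v = a *: Q x h u v.
Proof. by have := Q_linear1 h u v a x 0; rewrite Q01 !addr0. Qed.

Lemma QZ2 a x h u v : Q x (a *: h) u v = a *: Q x h u v.
Proof. by rewrite !(Q_sym12 x) QZ1. Qed.

Lemma QZ3 a x h u v : Q x h (a *: u) v = a *: Q x h u v.
Proof. by have := Q_linear3 x h v a u 0; rewrite Q03 !addr0. Qed.

Lemma QZ4 a x h u v : Q x h u (a *: v) = a *: Q x h u v.
Proof. by rewrite !(Q_sym34 _ _ u) QZ3. Qed.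

Lemma QN3 x h u v : Q x h (- u) v = - Q x h u v.
Proof. by rewrite -scaleN1r QZ3 scaleN1r. Qed.

Lemma QN2 x h u v : Q x (- h) u v = - Q x h u v.
Proof. by rewrite -scaleN1r QZ2 scaleN1r. Qed.

Lemma QN4 x h u v : Q x h u (- v) = - Q x h u v.
Proof. by rewrite -scaleN1r QZ4 scaleN1r. Qed.

Lemma smooth_Q (V : normedModType R) (f g h l : V -> E) :
  smooth_on setT f -> smooth_on setT g -> smooth_on setT h ->
  smooth_on setT l ->
  smooth_on setT (fun y => Q (f y) (g y) (h y) (l y)).
Proof.
move=> sf sg sh sl k.
apply: (@Ck_linear_arg _ _ _ k d (fun x y => Q x (g y) (h y) (l y))) => [y||x].
- exact: Q_linear1.
- exact: sf.
apply: (@Ck_linear_arg _ _ _ k d (fun z y => Q x z (h y) (l y))) => [y||z].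
- exact: Q_linear2.
- exact: sg.
apply: (@Ck_linear_arg _ _ _ k d (fun u y => Q x z u (l y))) => [y||u].
- exact: Q_linear3.
- exact: sh.
apply: (@Ck_linear_arg _ _ _ k d (fun v y => Q x z u v)) => [y||v].
- exact: Q_linear4.
- exact: sl.
- exact: Ck_cst.
Qed.

Lemma smooth_derivative_along (X Y : E -> E) :
  smooth_on setT X -> smooth_on setT Y ->
  smooth_on setT (fun q => 'd Y q (X q)).
Proof.
move=> sX sY k.
apply: (@Ck_linear_arg _ _ _ k d (fun u q => 'd Y q u)) => [q||u].
- exact: linearP.
- exact: sX.
have -> : (fun q => 'd Y q u) = 'D_u Y.
  by apply/funext => q; rewrite deriveE //; exact: smooth_differentiable.
by case: (sY k.+1) => _; apply.
Qed.

Definition quadratic_nabla (X Y : E -> E) : E -> E :=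
  fun q => 'd Y q (X q) + Q q q (X q) (Y q).

Lemma smooth_quadratic_nabla X Y : smooth_on setT X -> smooth_on setT Y ->
  smooth_on setT (quadratic_nabla X Y).
Proof.
move=> sX sY; apply: smoothD; first exact: smooth_derivative_along.
by apply: smooth_Q => //; exact: smooth_id.
Qed.

Lemma quadratic_nabla_linear_l (f : E -> R) X X' Y q :
  quadratic_nabla (fun r => f r *: X r + X' r) Y q =
  f q *: quadratic_nabla X Y q + quadratic_nabla X' Y q.
Proof. by rewrite /quadratic_nabla linearP QD3 QZ3 scalerDr addrACA. Qed.

Lemma quadratic_nabla_add_r X Y Y' q : differentiable Y q ->
  differentiable Y' q ->
  quadratic_nabla X (fun r => Y r + Y' r) q =
  quadratic_nabla X Y q + quadratic_nabla X Y' q.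
Proof.
move=> dY dY'; rewrite /quadratic_nabla QD4.
have dYY : 'd (fun r => Y r + Y' r) q (X q) = 'd Y q (X q) + 'd Y' q (X q).
  exact: (congr1 (fun F : E -> E => F (X q)) (diffD dY dY')).
exact: etrans (congr1 (+%R^~ _) dYY) (addrACA _ _ _ _).
Qed.

Lemma quadratic_nabla_leibniz (f : E -> R) X Y q : differentiable f q ->
  differentiable Y q ->
  quadratic_nabla X (fun r => f r *: Y r) q =
  'd f q (X q) *: Y q + f q *: quadratic_nabla X Y q.
Proof.
move=> df dY; rewrite /quadratic_nabla QZ4 scalerDr addrCA addrA.
have [_ dfY] := is_diff_scale df dY.
exact: (congr1 (fun F : E -> E => F (X q) + _) dfY).
Qed.

Definition quadratic_connection : affine_connection (euclid R d).
Proof.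
refine (@AffineConnection R d (euclid R d) quadratic_nabla _ _ _ _).
- move=> X Y /smooth_vf_euclid sX /smooth_vf_euclid sY; apply/smooth_vf_euclid.
  exact: smooth_quadratic_nabla.
- by move=> f X X' Y _ _ _ _ q; exact: quadratic_nabla_linear_l.
- move=> X Y Y' _ /smooth_vf_euclid sY /smooth_vf_euclid sY' q.
  exact: (quadratic_nabla_add_r X (smooth_differentiable q sY)
                                  (smooth_differentiable q sY')).
- move=> f X Y /smooth_fun_euclid sf _ /smooth_vf_euclid sY q.
  exact: (quadratic_nabla_leibniz X (smooth_differentiable q sf)
                                  (smooth_differentiable q sY)).
Defined.

Lemma quadratic_torsion_free : torsion_free quadratic_connection.
Proof.
move=> X Y _ _ q; rewrite bracket_euclid /= /quadratic_nabla.
by rewrite (Q_sym34 q q (Y q)) opprD addrACA subrr addr0.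
Qed.

(** The derivatives of the coordinates of Y and Z account for the whole left-hand
    side, since w is constant; the two terms in Gamma cancel because the
    assumption makes each endomorphism Gamma(x)(u, _) skew for w. *)
Lemma quadratic_parallel (w : E -> E -> R) (wl : forall v, scalar (w ^~ v))
    (wr : forall u, scalar (w u)) (wa : forall u, w u u = 0)
    (wn : forall u, (forall v, w u v = 0) -> u = 0) :
  (forall x h u v t, w (Q x h u v) t = w (Q x h u t) v) ->
  parallel_form quadratic_connection (constant_form wl wr wa wn).
Proof.
move=> wQ X Y Z _ /smooth_vf_euclid sY /smooth_vf_euclid sZ q.
rewrite vf_act_euclid /= diff_form //; try exact: smooth_differentiable.
rewrite /quadratic_nabla (formDl wl) (formDr wr).
rewrite (form_anti wl wr wa (Y q) (Q _ _ _ _)).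
by rewrite (wQ q q (X q) (Z q)); ring.
Qed.

Lemma quadratic_christoffel p x u v :
  christoffel quadratic_connection p x u v (Q x x u v).
Proof.
exists (cst u), (cst v); split; try by rewrite vf_in_euclid; near=> y.
- by apply/smooth_vf_euclid => k; apply: Ck_cst.
- by apply/smooth_vf_euclid => k; apply: Ck_cst.
- by rewrite vf_in_euclid /= /quadratic_nabla diff_cst add0r.
Unshelve. all: by end_near. Qed.

(** * Geodesics and geodesic symmetries *)

Hypothesis Q_range1 : forall a b c e h u v, Q (Q a b c e) h u v = 0.
Hypothesis Q_range3 : forall a b c e x h v, Q x h (Q a b c e) v = 0.
Hypothesis Q_diag : forall v, Q v v v v = 0.

(** The directions that Q sees neither as a base point nor as a velocity; by
    the symmetries, the first and third slots account for all four. *)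
Definition Qker (y : E) :=
  (forall h u v, Q y h u v = 0) /\ (forall x h v, Q x h y v = 0).

Lemma Qker_Q a b c e : Qker (Q a b c e).
Proof. by split. Qed.

Lemma QkerD y z : Qker y -> Qker z -> Qker (y + z).
Proof.
by move=> [y1 y3] [z1 z3]; split=> *; rewrite ?QD1 ?QD3 ?y1 ?z1 ?y3 ?z3 addr0.
Qed.

Lemma QkerZ a y : Qker y -> Qker (a *: y).
Proof. by move=> [y1 y3]; split=> *; rewrite ?QZ1 ?QZ3 ?y1 ?y3 scaler0. Qed.

(** Along geodesics, the corrections to straight lines lie in the range of Q, so
    they disappear inside Q. *)
Lemma Q_mod_ker y y' z z' x h u v : Qker y -> Qker y' -> Qker z -> Qker z' ->
  Q (x + y) (h + y') (u + z) (v + z') = Q x h u v.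
Proof.
move=> [y1 _] [y1' _] [_ z3] [_ z3'].
rewrite QD1 y1 addr0 Q_sym12 QD1 y1' addr0 Q_sym12.
by rewrite QD3 z3 addr0 Q_sym34 QD3 z3' addr0 Q_sym34.
Qed.

Definition quadratic_geodesic (x v : E) (t : R) : E :=
  x + t *: v + t ^+ 2 *: (- 2^-1 *: Q x x v v)
  + t ^+ 3 *: (- 3^-1 *: Q x v v v).

(** The exact solution: inside Gamma the curve may be replaced by the line
    x + t v, and Gamma along this line is Q x x v v + 2 t Q x v v v because
    Q v v v v = 0. *)
Lemma quadratic_geodesicP x v :
  geodesic quadratic_connection setT (quadratic_geodesic x v).
Proof.
pose a := - 2^-1 *: Q x x v v; pose b := - 3^-1 *: Q x v v v.
have sg : smooth_on setT (quadratic_geodesic x v) := smooth_cubic x v a b.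
split=> [||t p _ _]; first exact: openT.
  split=> [t _|p]; first exact: (sg 0%N).
  by rewrite setTI preimage_setT; exact: sg.
set c : R -> E := chart p \o _.
have cE s : c s = x + s *: v + s ^+ 2 *: a + s ^+ 3 *: b by [].
have dc := derive1_cubic cE.
exists (Q (c t) (c t) (derive1 c t) (derive1 c t)).
  exact: quadratic_christoffel.
have ddc : derive1 (derive1 c) t = - Q x x v v + (- 2 * t) *: Q x v v v.
  have c'E s : derive1 c s =
      v + s *: (2 *: a) + s ^+ 2 *: (3 *: b) + s ^+ 3 *: 0.
    by rewrite dc; apply/rowP => i; rewrite !mxE; ring.
  by rewrite (derive1_cubic c'E); apply/rowP => i; rewrite !mxE; field.
have [ka kb] : Qker a /\ Qker b by split; apply: QkerZ; exact: Qker_Q.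
have kc : Qker (t ^+ 2 *: a + t ^+ 3 *: b) by apply: QkerD; exact: QkerZ.
have kc' : Qker ((2 * t) *: a + (3 * t ^+ 2) *: b).
  by apply: QkerD; exact: QkerZ.
rewrite derive1nS derive1n1 ddc dc cE -![_ + _ *: a + _]addrA.
rewrite Q_mod_ker // !QD1 !QD2 !QZ1 !QZ2 Q_diag (Q_sym12 v x).
by apply/rowP => i; rewrite !mxE; ring.
Qed.

(** The time-one value of [quadratic_geodesic]. *)
Definition quadratic_exp (x v : E) : E :=
  x + v - 2^-1 *: Q x x v v - 3^-1 *: Q x v v v.

(** The inverse has the same shape with opposite signs, because [y - x] differs
    from the initial velocity by an element of [Qker]. *)
Definition quadratic_log (x y : E) : E :=
  y - x + 2^-1 *: Q x x (y - x) (y - x) + 3^-1 *: Q x (y - x) (y - x) (y - x).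

Lemma quadratic_expP (x : euclid R d) v :
  is_exp quadratic_connection x v (quadratic_exp x v).
Proof.
exists setT, (quadratic_geodesic x v); split=> //.
- exact: quadratic_geodesicP.
- by rewrite /quadratic_geodesic !expr0n /= !scale0r !addr0.
- have cE s : (chart x \o quadratic_geodesic x v) s = x + s *: v
      + s ^+ 2 *: (- 2^-1 *: Q x x v v) + s ^+ 3 *: (- 3^-1 *: Q x v v v) by [].
  by rewrite (derive1_cubic cE) mulr0 expr0n /= mulr0 !scale0r !addr0.
- rewrite /quadratic_geodesic /quadratic_exp !expr1n !scale1r.
  by rewrite !scaleNr.
Qed.

Lemma quadratic_expK x : cancel (quadratic_exp x) (quadratic_log x).
Proof.
move=> v; rewrite /quadratic_log.
pose k := (- 2^-1) *: Q x x v v + (- 3^-1) *: Q x v v v.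
have kk : Qker k by apply: QkerD; apply: QkerZ; exact: Qker_Q.
have k0 : Qker 0 by split=> *; rewrite ?Q01 ?Q03.
have -> : quadratic_exp x v - x = v + k.
  by rewrite /quadratic_exp /k; apply/rowP => i; rewrite !mxE; ring.
have -> : Q x x (v + k) (v + k) = Q x x v v.
  by have := @Q_mod_ker 0 0 k k x x v v k0 k0 kk kk; rewrite !addr0.
have -> : Q x (v + k) (v + k) (v + k) = Q x v v v.
  by have := @Q_mod_ker 0 k k k x v v v k0 kk kk kk; rewrite !addr0.
by rewrite /k; apply/rowP => i; rewrite !mxE; ring.
Qed.

Lemma quadratic_logK x : cancel (quadratic_log x) (quadratic_exp x).
Proof.
move=> y; rewrite /quadratic_exp /quadratic_log; set z := y - x.
pose k := 2^-1 *: Q x x z z + 3^-1 *: Q x z z z.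
have kk : Qker k by apply: QkerD; apply: QkerZ; exact: Qker_Q.
have k0 : Qker 0 by split=> *; rewrite ?Q01 ?Q03.
have -> : z + 2^-1 *: Q x x z z + 3^-1 *: Q x z z z = z + k by rewrite addrA.
have -> : Q x x (z + k) (z + k) = Q x x z z.
  by have := @Q_mod_ker 0 0 k k x x z z k0 k0 kk kk; rewrite !addr0.
have -> : Q x (z + k) (z + k) (z + k) = Q x z z z.
  by have := @Q_mod_ker 0 k k k x z z z k0 kk kk kk; rewrite !addr0.
by rewrite /k /z; apply/rowP => i; rewrite !mxE; ring.
Qed.

(** The two copies of the even term - 1/2 Q x x z z, from the logarithm and from
    the exponential, add up; those of the odd term 1/3 Q x z z z cancel. *)
Lemma quadratic_symmetryE x y :
  quadratic_exp x (- quadratic_log x y) =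
  x - (y - x) - Q x x (y - x) (y - x).
Proof.
rewrite /quadratic_exp /quadratic_log; set z := y - x.
pose k := - 2^-1 *: Q x x z z - 3^-1 *: Q x z z z.
have kk : Qker k.
  by rewrite /k -scaleNr; apply: QkerD; apply: QkerZ; exact: Qker_Q.
have k0 : Qker 0 by split=> *; rewrite ?Q01 ?Q03.
have -> : - (z + 2^-1 *: Q x x z z + 3^-1 *: Q x z z z) = - z + k.
  by rewrite /k; apply/rowP => i; rewrite !mxE; ring.
have -> : Q x x (- z + k) (- z + k) = Q x x z z.
  have := @Q_mod_ker 0 0 k k x x (- z) (- z) k0 k0 kk kk.
  by rewrite !addr0 QN3 QN4 opprK.
have -> : Q x (- z + k) (- z + k) (- z + k) = - Q x z z z.
  have := @Q_mod_ker 0 k k k x (- z) (- z) (- z) k0 kk kk kk.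
  by rewrite !addr0 QN2 QN3 QN4 opprK.
by rewrite /k; apply/rowP => i; rewrite !mxE; field.
Qed.

Lemma smooth_quadratic_exp x : smooth_on setT (quadratic_exp x).
Proof.
rewrite (_ : quadratic_exp x = fun v =>
    x + v + - 2^-1 *: Q x x v v + - 3^-1 *: Q x v v v); last first.
  by apply/funext => v; rewrite /quadratic_exp !scaleNr.
by do 3?apply: smoothD; try apply: smoothZ; try apply: smooth_Q;
  try exact: smooth_cst; exact: smooth_id.
Qed.

Lemma smooth_quadratic_log x : smooth_on setT (quadratic_log x).
Proof.
have sz : smooth_on setT (fun y : E => y - x).
  by apply: smoothD; [exact: smooth_id|exact: smooth_cst].
apply: smoothD; first apply: smoothD => //; apply: smoothZ;
  apply: smooth_Q => //; exact: smooth_cst.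
Qed.

Lemma quadratic_normal_nbhd (x : euclid R d) :
  symmetric_normal_nbhd quadratic_connection x setT
    (quadratic_exp x : E -> euclid R d) setT (quadratic_log x).
Proof.
split=> //; first exact: openT.
split=> //.
- by move=> v _; exact: quadratic_expP.
- exact: openT.
- apply/seteqP; split=> // y _; exists (quadratic_log x y) => //.
  exact: quadratic_logK.
- by move=> v _; exact: quadratic_expK.
split.
  split=> [v _|p]; first exact: (smooth_quadratic_exp x 0%N).
  by rewrite setTI preimage_setT; exact: smooth_quadratic_exp.
by move=> p; rewrite setTI image_id; exact: smooth_quadratic_log.
Qed.

Lemma diff_quadratic_symmetry x y u :
  'd (fun y => quadratic_exp x (- quadratic_log x y)) y u =
  - u - 2 *: Q x x (y - x) u.
Proof.
have -> : (fun y => quadratic_exp x (- quadratic_log x y)) =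
          (fun y => x + -1 *: (y - x) + -1 *: Q x x (y - x) (y - x)).
  by apply/funext => z; rewrite quadratic_symmetryE !scaleN1r.
have sz : smooth_on setT (fun y : E => y - x).
  by apply: smoothD; [exact: smooth_id|exact: smooth_cst].
rewrite -deriveE; last first.
  apply: smooth_differentiable; apply: smoothD; first apply: smoothD.
  - exact: smooth_cst.
  - exact: smoothZ.
  - by apply: smoothZ; apply: smooth_Q => //; exact: smooth_cst.
apply: (@derive_expand _ _ _ _ _ _ _ (- Q x x u u) 0) => t.
have -> : t *: u + y - x = t *: u + (y - x) by rewrite addrA.
move: (y - x) => z.
rewrite QD3 !QD4 !QZ3 !QZ4 (Q_sym34 x x z u).
by apply/rowP => i; rewrite !mxE; ring.
Qed.

Section Invariance.
Variable w : E -> E -> R.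
Hypothesis w_linear_l : forall v, scalar (w ^~ v).
Hypothesis w_linear_r : forall u, scalar (w u).
Hypothesis w_alternating : forall u, w u u = 0.
Hypothesis w_nondegenerate : forall u, (forall v, w u v = 0) -> u = 0.
Hypothesis w_Q : forall x h u v t, w (Q x h u v) t = w (Q x h u t) v.

(** The endomorphism A = 2 Q x x h is skew for w by the total symmetry of Q, and
    A^2 = 0; so w ((1 + A) u) ((1 + A) v) = w u v + w (A u) v + w u (A v)
    + w (A u) (A v) = w u v. *)
Lemma quadratic_symmetry_invariant x h u v :
  w (- u - 2 *: Q x x h u) (- v - 2 *: Q x x h v) = w u v.
Proof.
have wD := formDl w_linear_l; have wD' := formDr w_linear_r.
have wN := formNl w_linear_l; have wN' := formNr w_linear_r.
have wZ := formZl w_linear_l; have wZ' := formZr w_linear_r.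
rewrite !wD !wD' !wN !wN' !wZ !wZ'.
rewrite (w_Q x x h u (Q _ _ _ _)) (Q_sym34 x x h (Q _ _ _ _)) Q_range3.
rewrite (form0l w_linear_l).
rewrite (form_anti w_linear_l w_linear_r w_alternating u (Q _ _ _ _)).
rewrite (w_Q x x h v u).
by ring.
Qed.

Lemma quadratic_S_type :
  S_type (constant_form w_linear_l w_linear_r w_alternating w_nondegenerate)
         quadratic_connection.
Proof.
move=> x.
exists setT, (quadratic_exp x : E -> euclid R d), setT, (quadratic_log x).
split; first exact: quadratic_normal_nbhd.
move=> q _ u v ds; rewrite /= /ds.
have dsE u' : ds u' = - u' - 2 *: Q x x ((q : E) - x) u'.
  exact: diff_quadratic_symmetry.
exact: etrans (congr2 w (dsE u) (dsE v)) (quadratic_symmetry_invariant _ _ _ _).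
Qed.

End Invariance.

(** * Curvature *)

Lemma diff_Gamma u v q h : 'd (fun q => Q q q u v) q h = 2 *: Q q h u v.
Proof.
rewrite -deriveE; last first.
  apply: smooth_differentiable; apply: smooth_Q;
    by [exact: smooth_id|exact: smooth_cst].
apply: (@derive_expand _ _ _ _ _ _ _ (Q h h u v) 0) => t.
rewrite QD1 !QD2 !QZ1 !QZ2 (Q_sym12 h q).
by apply/rowP => i; rewrite !mxE; ring.
Qed.

Lemma diff_DGamma x u v q h : 'd (fun q => Q q x u v) q h = Q h x u v.
Proof.
rewrite -deriveE; last first.
  apply: smooth_differentiable; apply: smooth_Q;
    by [exact: smooth_id|exact: smooth_cst].
apply: (@derive_expand _ _ _ _ _ _ _ 0 0) => t.
by rewrite QD1 QZ1 !scaler0 !addr0 addrC.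
Qed.

Lemma diff_cst_at (u : E) q h : 'd (cst u : E -> E) q h = 0.
Proof. exact: (congr1 (fun F : E -> E => F h) (diff_cst u q)). Qed.

Lemma nabla_cst X (u : E) q : quadratic_nabla X (cst u) q = Q q q (X q) u.
Proof.
exact: etrans (congr1 (fun a => a + _) (diff_cst_at u q (X q))) (add0r _).
Qed.

Lemma nabla_Gamma X u v q :
  quadratic_nabla X (fun q => Q q q u v) q = 2 *: Q q (X q) u v.
Proof.
by rewrite /quadratic_nabla diff_Gamma (Q_sym34 _ _ (X q)) Q_range3 addr0.
Qed.

Lemma nabla_DGamma X h u v q :
  quadratic_nabla X (fun q => Q q h u v) q = Q (X q) h u v.
Proof.
by rewrite /quadratic_nabla diff_DGamma (Q_sym34 _ _ (X q)) Q_range3 addr0.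
Qed.

(** The bracket, the curvature and the fields below are stated for plain maps
    of row vectors, where the charts of the manifold have disappeared. *)
Definition row_bracket (X Y : E -> E) : E -> E :=
  fun q => 'd Y q (X q) - 'd X q (Y q).

Definition row_curvature (X Y Z : E -> E) : E -> E := fun q =>
  quadratic_nabla X (quadratic_nabla Y Z) q
  - quadratic_nabla Y (quadratic_nabla X Z) q
  - quadratic_nabla (row_bracket X Y) Z q.

Lemma curvatureE X Y Z :
  curvature quadratic_connection X Y Z = row_curvature X Y Z.
Proof.
apply/funext => q; rewrite /curvature.
have -> : bracket X Y = row_bracket X Y.
  by apply/funext => r; exact: bracket_euclid.
by [].
Qed.

Let Gamma u v : E -> E := fun q => Q q q u v.

Lemma nabla_cst_fun (X : E -> E) (u : E) :
  quadratic_nabla X (cst u) = fun q => Q q q (X q) u.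
Proof. by apply/funext => q; exact: nabla_cst. Qed.

Lemma row_bracketE X Y q a b : 'd Y q (X q) = a -> 'd X q (Y q) = b ->
  row_bracket X Y q = a - b.
Proof. exact: (congr2 (fun a b : E => a - b)). Qed.

Lemma row_bracket_cst u v q : row_bracket (cst u) (cst v) q = 0.
Proof.
by rewrite (row_bracketE (diff_cst_at _ _ _) (diff_cst_at _ _ _)) subr0.
Qed.

Lemma row_bracket_Gamma_l a b y q :
  row_bracket (Gamma a b) (cst y) q = - 2 *: Q q y a b.
Proof.
rewrite (row_bracketE (diff_cst_at _ _ _) (diff_Gamma _ _ _ _)).
by rewrite sub0r scaleNr.
Qed.

Lemma row_bracket_Gamma_r a b x q :
  row_bracket (cst x) (Gamma a b) q = 2 *: Q q x a b.
Proof.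
by rewrite (row_bracketE (diff_Gamma _ _ _ _) (diff_cst_at _ _ _)) subr0.
Qed.

Lemma curvature_cst x y z :
  row_curvature (cst x) (cst y) (cst z) =
  fun q => Q q (2 *: x) y z + Q q (- 2 *: y) x z.
Proof.
apply/funext => q; rewrite /row_curvature !nabla_cst_fun !nabla_Gamma.
by rewrite row_bracket_cst Q03 subr0 !QZ2 scaleNr.
Qed.

(** The covariant derivative of one constant field along another is of the form
    [Gamma a b], with values in the range of Q.  Inserted in R, such a field
    gives zero: in the first two slots because Q kills it and its derivatives,
    in the third because the second derivatives of Gamma commute. *)
Lemma curvature_Gamma1 a b y z q :
  row_curvature (Gamma a b) (cst y) (cst z) q = 0.
Proof.
rewrite /row_curvature !nabla_cst_fun nabla_Gamma Q_sym12 Q_range1 scaler0.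
have -> : (fun q => Q q q (Gamma a b q) z) = cst 0.
  by apply/funext => r; exact: Q_range3.
rewrite nabla_cst_fun Q_sym34 Q03 row_bracket_Gamma_l QZ3 Q_range3.
by rewrite scaler0 !subr0.
Qed.

Lemma curvature_Gamma2 a b x z q :
  row_curvature (cst x) (Gamma a b) (cst z) q = 0.
Proof.
rewrite /row_curvature !nabla_cst_fun nabla_Gamma Q_sym12 Q_range1 scaler0.
have -> : (fun q => Q q q (Gamma a b q) z) = cst 0.
  by apply/funext => r; exact: Q_range3.
rewrite nabla_cst_fun Q_sym34 Q03 row_bracket_Gamma_r QZ3 Q_range3.
by rewrite scaler0 !subr0.
Qed.

Lemma curvature_Gamma3 a b x y q :
  row_curvature (cst x) (cst y) (Gamma a b) q = 0.
Proof.
have nG (u : E) :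
    quadratic_nabla (cst u) (Gamma a b) = fun q => Q q (2 *: u) a b.
  by apply/funext => r; rewrite nabla_Gamma QZ2.
rewrite /row_curvature !nG !nabla_DGamma /= nabla_Gamma row_bracket_cst.
by rewrite !QZ2 (Q_sym12 y x) subrr Q_sym12 Q01 scaler0 subr0.
Qed.

Lemma quadratic_nabla_curvature (p x y z : E) (q : euclid R d) :
  nabla_curvature quadratic_connection (cst p) (cst x) (cst y) (cst z) q =
  2 *: (Q p x y z - Q p y x z).
Proof.
rewrite /nabla_curvature !curvatureE /= !nabla_cst_fun.
rewrite curvature_Gamma1 curvature_Gamma2 curvature_Gamma3 !subr0.
rewrite curvature_cst quadratic_nabla_add_r.
- by rewrite !nabla_DGamma !QZ2 scaleNr scalerBr.
- apply: smooth_differentiable; apply: smooth_Q;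
    by [exact: smooth_id|exact: smooth_cst].
- apply: smooth_differentiable; apply: smooth_Q;
    by [exact: smooth_id|exact: smooth_cst].
Qed.

Lemma quadratic_not_locally_symmetric (p x y z : E) :
  Q p x y z <> Q p y x z -> ~ locally_symmetric quadratic_connection.
Proof.
move=> neq /(_ (cst p) (cst x) (cst y) (cst z)) sym; apply: neq.
have sc (u : E) : smooth_vf (cst u : vfield (euclid R d)).
  by apply/smooth_vf_euclid; exact: smooth_cst.
have /eqP := sym (sc _) (sc _) (sc _) (sc _) (0 : E).
by rewrite quadratic_nabla_curvature scaler_eq0 pnatr_eq0 /= subr_eq0 => /eqP.
Qed.

End QuadraticConnection.

(** * The standard symplectic form *)

Section StandardForm.
Variables (R : realType) (n : nat).
Local Notation E := 'rV[R]_(n + n).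

Definition standard_form (u v : E) : R :=
  \sum_(i < n) (lsubmx u 0 i * rsubmx v 0 i - rsubmx u 0 i * lsubmx v 0 i).

Lemma standard_form_linear_l v : scalar (standard_form ^~ v).
Proof.
move=> a u u'; rewrite /standard_form mulr_sumr -big_split /=.
by apply: eq_bigr => i _; rewrite !mxE; ring.
Qed.

Lemma standard_form_linear_r u : scalar (standard_form u).
Proof.
move=> a v v'; rewrite /standard_form mulr_sumr -big_split /=.
by apply: eq_bigr => i _; rewrite !mxE; ring.
Qed.

Lemma standard_form_alternating u : standard_form u u = 0.
Proof. by apply: big1 => i _; rewrite mulrC subrr. Qed.

(** Pairing u with J u, for the standard complex structure J, gives the sum of
    the squares of the coordinates of u. *)
Lemma standard_form_nondegenerate u :
  (forall v, standard_form u v = 0) -> u = 0.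
Proof.
move=> /(_ (row_mx (- rsubmx u) (lsubmx u))).
rewrite /standard_form row_mxKl row_mxKr.
under eq_bigr => i _ do rewrite [(- rsubmx u) 0 i]mxE mulrN opprK -!expr2.
move=> /eqP; rewrite psumr_eq0 => [|i _]; last by rewrite addr_ge0 ?sqr_ge0.
move=> /allP u0; rewrite -(hsubmxK u).
have ui i : lsubmx u 0 i = 0 /\ rsubmx u 0 i = 0.
  have := u0 i (mem_index_enum i).
  by rewrite /= paddr_eq0 ?sqr_ge0 // !sqrf_eq0 => /andP[/eqP ? /eqP ?].
have -> : lsubmx u = 0.
  by apply/rowP => i; rewrite [RHS]mxE; case: (ui i).
have -> : rsubmx u = 0.
  by apply/rowP => i; rewrite [RHS]mxE; case: (ui i).
exact: row_mx0.
Qed.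

End StandardForm.

(** * A tensor built from the area form of the plane *)

Section AreaTensor.
Variables (R : realType) (m : nat).
Local Notation n := m.+2.
Local Notation E := 'rV[R]_(n + n).
Implicit Types x h u v t : E.

Let q1 u : R := lsubmx u 0 0.
Let q2 u : R := lsubmx u 0 1.
Let theta x u : R := q1 x * q2 u - q2 x * q1 u.

Let coef x u v : R := theta x u * q1 v + theta x v * q1 u.

Definition momentum (a b : R) : E :=
  row_mx 0 (a *: delta_mx 0 0 + b *: delta_mx 0 1).

(** Up to sign, w (area_tensor x x u v) t is twice
      theta x u * theta x v * q1 t + theta x u * q1 v * theta x t
      + q1 u * theta x v * theta x t,
    the polarization of 3 (theta x v)^2 (q1 v): the two arguments of [momentum]
    are the coefficients of q1 t and q2 t, made symmetric in x and h. *)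
Definition area_tensor x h u v : E :=
  momentum (theta x u * theta h v + theta h u * theta x v
            - q2 h * coef x u v - q2 x * coef h u v)
           (q1 h * coef x u v + q1 x * coef h u v).

Lemma momentum_linear (c a b a' b' : R) :
  c *: momentum a b + momentum a' b' = momentum (c * a + a') (c * b + b').
Proof.
rewrite /momentum scale_row_mx add_row_mx scaler0 addr0.
by rewrite scalerDr !scalerA !scalerDl addrACA.
Qed.

Lemma momentum0 : momentum 0 0 = 0.
Proof. by rewrite /momentum !scale0r addr0 row_mx0. Qed.

Lemma position_momentum a b : (q1 (momentum a b) = 0) * (q2 (momentum a b) = 0).
Proof. by rewrite /q1 /q2 row_mxKl !mxE. Qed.

Lemma position_linear (a : R) x y : (q1 (a *: x + y) = a * q1 x + q1 y) *
   (q2 (a *: x + y) = a * q2 x + q2 y).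
Proof. by split; rewrite /q1 /q2 !mxE. Qed.

Lemma area_tensor_linear1 h u v : linear (fun x => area_tensor x h u v).
Proof.
move=> a x y; rewrite momentum_linear.
by congr momentum; rewrite /coef /theta !position_linear; ring.
Qed.

Lemma area_tensor_linear3 x h v : linear (fun u => area_tensor x h u v).
Proof.
move=> a u u'; rewrite momentum_linear.
by congr momentum; rewrite /coef /theta !position_linear; ring.
Qed.

Lemma area_tensor_sym12 x h u v : area_tensor x h u v = area_tensor h x u v.
Proof. by congr momentum; ring. Qed.

Lemma area_tensor_sym34 x h u v : area_tensor x h u v = area_tensor x h v u.
Proof. by congr momentum; rewrite /coef; ring. Qed.

Lemma area_tensor_range1 a b c e h u v :
  area_tensor (area_tensor a b c e) h u v = 0.
Proof.
rewrite -momentum0; congr momentum;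
  by rewrite /coef /theta !(position_momentum (_ - _)); ring.
Qed.

Lemma area_tensor_range3 a b c e x h v :
  area_tensor x h (area_tensor a b c e) v = 0.
Proof.
rewrite -momentum0; congr momentum;
  by rewrite /coef /theta !(position_momentum (_ - _)); ring.
Qed.

Lemma area_tensor_diag v : area_tensor v v v v = 0.
Proof. by rewrite -momentum0; congr momentum; rewrite /coef /theta; ring. Qed.

Lemma standard_form_momentum a b t :
  standard_form (momentum a b) t = - (a * q1 t + b * q2 t).
Proof.
rewrite /standard_form row_mxKl row_mxKr !big_ord_recl big1 => [|i _].
  have -> : lift ord0 ord0 = 1 :> 'I_n by exact: val_inj.
  by rewrite /q1 /q2 !mxE /=; ring.
by rewrite !mxE /=; ring.
Qed.

Lemma standard_form_area_tensor x h u v t :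
  standard_form (area_tensor x h u v) t = standard_form (area_tensor x h u t) v.
Proof. by rewrite !standard_form_momentum /coef /theta; ring. Qed.

Lemma area_tensor_swap23 :
  exists p x y z, area_tensor p x y z <> area_tensor p y x z.
Proof.
pose e i : E := row_mx (delta_mx 0 i) 0.
exists (e 0), (e 0), (e 1), (e 1) => /(congr1 (fun u => rsubmx u 0 0)).
have q1E i : q1 (e i) = (0 == i)%:R by rewrite /q1 row_mxKl mxE eqxx.
have q2E i : q2 (e i) = (1 == i)%:R by rewrite /q2 row_mxKl mxE eqxx.
(* The first momentum coordinates are 2 on the left and -2 on the right. *)
rewrite !row_mxKr !mxE /coef /theta !q1E !q2E /=.
move=> eq22; suff /eqP : 4%:R = 0 :> R by rewrite pnatr_eq0.
by lra.
Qed.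

End AreaTensor.

Theorem corollary0p5p5 (R : realType) (n : nat) (hn : (2 <= n)%N) :
  exists F : fedosov_manifold R (2 * n)%N,
    S_type (fed_form F) (fed_connection F) /\
    ~ locally_symmetric (fed_connection F).
Proof.
case: n hn => [|[|m]] // _; rewrite mul2n -addnn.
pose D := quadratic_connection (@area_tensor_linear1 R m)
  (@area_tensor_linear3 R m) (@area_tensor_sym12 R m) (@area_tensor_sym34 R m).
pose w := constant_form (@standard_form_linear_l R m.+2)
  (@standard_form_linear_r R m.+2) (@standard_form_alternating R m.+2)
  (@standard_form_nondegenerate R m.+2).
have Dw : parallel_form D w.
  exact/quadratic_parallel/standard_form_area_tensor.
have D0 : torsion_free D by exact: quadratic_torsion_free.
exists (FedosovManifold D0 Dw); split.
  apply: quadratic_S_type.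
  - exact: area_tensor_range1.
  - exact: area_tensor_range3.
  - exact: area_tensor_diag.
  - exact: standard_form_area_tensor.
have [p [x [y [z]]]] := area_tensor_swap23 R m.
apply: quadratic_not_locally_symmetric; first exact: area_tensor_range1.
exact: area_tensor_range3.
Qed.
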